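(* Let $n\ge1$, suppose $\varphi\in\mathcal F^2(\mathbb C^n)$ is such that $S_\varphi$ is bounded on $\mathcal F^2(\mathbb C^n)$, and let $$\varphi(z)=\left(\frac{2}{\pi}\right)^{n/2}\int_{\mathbb R^n}m(x)\,e^{-2\left(x-\frac i2 z\right)^2}\,dx,\qquad z\in\mathbb C^n,$$ for some $m\in L^\infty(\mathbb R^n)$. Then $S_\varphi$ is compact if and only if $\varphi=0$.
   Context: $d\lambda(z)=\pi^{-n}e^{-|z|^2}\,dz$ is the Gaussian measure on $\mathbb C^n$. The Fock space $\mathcal F^2(\mathbb C^n)$ is the Hilbert space of all entire functions $F$ on $\mathbb C^n$ with $\|F\|^2_{\mathcal F^2(\mathbb C^n)}=\int_{\mathbb C^n}|F(z)|^2\,d\lambda(z)<\infty$. For $\varphi\in\mathcal F^2(\mathbb C^n)$, $$S_\varphi F(z)=\int_{\mathbb C^n}F(w)\,e^{z\cdot\bar w}\,\varphi(z-\bar w)\,d\lambda(w),\qquad z\in\mathbb C^n,$$ where $z\cdot\bar w=\sum_j z_j\bar w_j$; for $a\in\mathbb C^n$, $a^2=\sum_j a_j^2$ (bilinear). ''$S_\varphi$ is bounded'' means that this formula defines a bounded linear operator from $\mathcal F^2(\mathbb C^n)$ to itself; such a bounded $m$ representing $\varphi$ is then known to exist. *)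

(* Defs.v *)
From HB Require Import structures.
From mathcomp Require Import all_boot all_order all_algebra.
From mathcomp Require Import complex.
From mathcomp Require Import all_classical all_reals all_analysis.

Set Implicit Arguments.
Unset Strict Implicit.
Unset Printing Implicit Defensive.

Import Order.TTheory GRing.Theory Num.Theory.
Import numFieldNormedType.Exports.
Import ComplexField.Normc.

Local Open Scope classical_set_scope.
Local Open Scope ring_scope.
Local Open Scope complex_scope.

(* R[i] packed as a numFieldType: the normed-space structure of row vectors   *)
(* is declared over a generic numFieldType, and is not found on the bare      *)
(* carrier R[i].                                                              *)
Definition C (R : realType) : numFieldType := R[i].

Notation Rn R n := (n.-tuple (measurableTypeR R)).
Notation Cn R n := ('rV[C R]_n).

Section lebesgue_measure_Rn.
Context (R : realType).

Definition consRn n (p : measurableTypeR R * Rn R n) : Rn R n.+1 :=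
  [tuple of p.1 :: p.2].

Definition unconsRn n (t : Rn R n.+1) : measurableTypeR R * Rn R n :=
  (tnth t ord0, [tuple of behead t]).

Lemma consRnK n : cancel (@consRn n) (@unconsRn n).
Proof.
by case=> x t; rewrite /unconsRn/= tnth0; congr (_, _); exact/val_inj.
Qed.

Lemma measurable_consRn n : measurable_fun [set: _] (@consRn n).
Proof. exact: measurable_cons. Qed.

Lemma measurable_unconsRn n : measurable_fun [set: _] (@unconsRn n).
Proof.
by apply: measurable_fun_pair; [exact: measurable_tnth|exact: measurable_behead].
Qed.

Section step.
Local Open Scope ereal_scope.
Variables (n : nat) (mu : {sigma_finite_measure set (Rn R n) -> \bar R}).

Let prod : {measure set (measurableTypeR R * Rn R n)%type -> \bar R} :=
  (@lebesgue_measure R \x mu)%E.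

Definition lebesgueRnS : set (Rn R n.+1) -> \bar R :=
  pushforward (@lebesgue_measure R \x mu) (@consRn n).

Let preim (A : set (Rn R n.+1)) : measurable A -> measurable (@consRn n @^-1` A).
Proof.
by move=> mA; rewrite -[X in measurable X]setTI; exact: measurable_consRn.
Qed.

Let lebesgueRnS0 : lebesgueRnS set0 = 0.
Proof. by rewrite /lebesgueRnS /pushforward preimage_set0 (measure0 prod). Qed.

Let lebesgueRnS_ge0 A : 0 <= lebesgueRnS A.
Proof. exact: (measure_ge0 prod). Qed.

Let lebesgueRnS_sigma_additive : semi_sigma_additive lebesgueRnS.
Proof.
move=> F mF tF mUF; rewrite /lebesgueRnS /pushforward preimage_bigcup.
apply: (@measure_semi_sigma_additive _ _ _ prod).
- by move=> i; exact: preim.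
- apply/trivIsetP => /= i j _ _ ij; rewrite -preimage_setI.
  by move/trivIsetP : tF => /(_ _ _ _ _ ij) ->//; rewrite preimage_set0.
- by rewrite -preimage_bigcup; exact: preim.
Qed.

HB.instance Definition _ := isMeasure.Build _ _ _ lebesgueRnS
  lebesgueRnS0 lebesgueRnS_ge0 lebesgueRnS_sigma_additive.

Let lebesgueRnS_sigma_finite : sigma_finite setT lebesgueRnS.
Proof.
have /sigma_finiteP[F [TF ndF Foo]] := sigma_finiteT (@lebesgue_measure R).
have /sigma_finiteP[G [TG ndG Goo]] := sigma_finiteT mu.
exists (fun i => @unconsRn n @^-1` (F i `*` G i)).
  rewrite -preimage_bigcup (_ : \bigcup_i _ = setT) ?preimage_setT//.
  apply/seteqP; split=> // -[x y] _.
  have [i _ Fx] : (\bigcup_i F i) x by rewrite -TF.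
  have [j _ Gy] : (\bigcup_i G i) y by rewrite -TG.
  exists (maxn i j) => //; split=> /=.
  - by move: x Fx; exact/subsetPset/ndF/leq_maxl.
  - by move: y Gy; exact/subsetPset/ndG/leq_maxr.
move=> i; have [mF Fioo] := Foo i; have [mG Gioo] := Goo i; split.
  rewrite -[X in measurable X]setTI; apply: measurable_unconsRn => //.
  exact: measurableX.
rewrite /lebesgueRnS /pushforward -comp_preimage.
rewrite (_ : _ \o _ = id); last by apply/funext => x/=; rewrite consRnK.
by rewrite preimage_id product_measure1E// lte_mul_pinfty// ge0_fin_numE.
Qed.

HB.instance Definition _ := Measure_isSigmaFinite.Build _ _ _ lebesgueRnS
  lebesgueRnS_sigma_finite.

End step.

Fixpoint lebesgueRn n : {sigma_finite_measure set (Rn R n) -> \bar R} :=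
  match n with
  | 0 => \d_([tuple] : Rn R 0)
  | k.+1 => lebesgueRnS (lebesgueRn k)
  end.

End lebesgue_measure_Rn.

Section complex_integral.
Context (R : realType).

Definition cexp (z : C R) : C R :=
  (expR (complex.Re z))%:C * (cos (complex.Im z) +i* sin (complex.Im z)).

Context d (T : measurableType d).
Implicit Types (mu : {measure set T -> \bar R}) (f : T -> C R).

Definition cmeasurable f :=
  measurable_fun [set: T] (fun x => complex.Re (f x)) /\
  measurable_fun [set: T] (fun x => complex.Im (f x)).

Definition cintegrable mu f :=
  mu.-integrable [set: T] (fun x => (complex.Re (f x))%:E) /\
  mu.-integrable [set: T] (fun x => (complex.Im (f x))%:E).

Definition cintegral mu f : C R :=
  (\int[mu]_(x in [set: T]) complex.Re (f x)) +i* (\int[mu]_(x in [set: T]) complex.Im (f x)).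

Definition in_Linfty mu f :=
  cmeasurable f /\ ('N[mu]_+oo[(fun x => (normc (f x))%:E)] < +oo)%E.

End complex_integral.

Section Fock_space.
Context (R : realType) (n : nat).
Implicit Types (z w : Cn R n) (F G : Cn R n -> C R)
  (T : (Cn R n -> C R) -> (Cn R n -> C R)).

(* C^n is integrated over as R^n x R^n, the pair (x, y) standing for x + iy.  *)
Definition lebesgueCn : {measure set (Rn R n * Rn R n)%type -> \bar R} :=
  (lebesgueRn R n \x lebesgueRn R n)%E.

Definition pointCn (p : Rn R n * Rn R n) : Cn R n :=
  \row_j (tnth p.1 j +i* tnth p.2 j : C R).

Definition gauss_density z : R :=
  pi ^- n * expR (- \sum_j normc (z ord0 j) ^+ 2).

Definition gauss_integrable F :=
  cintegrable lebesgueCn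
    (fun p => F (pointCn p) * (gauss_density (pointCn p))%:C).

Definition gauss_integral F : C R :=
  cintegral lebesgueCn
    (fun p => F (pointCn p) * (gauss_density (pointCn p))%:C).

(* complex Frechet differentiability: the scalar field is C R *)
Definition entire F := forall z, differentiable F z.

Definition fock_sqnorm F : \bar R :=
  (\int[lebesgueCn]_p
     (normc (F (pointCn p)) ^+ 2 * gauss_density (pointCn p))%:E)%E.

Definition in_fock F := entire F /\ (fock_sqnorm F < +oo)%E.

Definition fock_norm F : R := Num.sqrt (fine (fock_sqnorm F)).

Definition bounded_linear_on_fock T :=
  [/\ forall F, in_fock F -> in_fock (T F),
      forall (a : C R) F G, in_fock F -> in_fock G ->
        T (fun z => a * F z + G z) = (fun z => a * T F z + T G z)
    & exists M : R, forall F, in_fock F -> fock_norm (T F) <= M * fock_norm F].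

(* every norm-bounded sequence has a subsequence with norm-convergent image   *)
Definition compact_on_fock T :=
  forall F_ : nat -> Cn R n -> C R,
    (forall k, in_fock (F_ k)) ->
    (exists M : R, forall k, fock_norm (F_ k) <= M) ->
    exists (s : nat -> nat) (G : Cn R n -> C R),
      [/\ {homo s : i j / (i < j)%N}, in_fock G
        & fock_norm (fun z => T (F_ (s k)) z - G z) @[k --> \oo] --> (0 : R)].

Definition conjCn w : Cn R n := \row_j ((w ord0 j)^* : C R).

Definition dotCn z w : C R := \sum_j z ord0 j * w ord0 j.

Definition S_integrand (phi F : Cn R n -> C R) z w : C R :=
  F w * cexp (dotCn z (conjCn w)) * phi (z - conjCn w).

Definition S_op (phi F : Cn R n -> C R) z : C R :=
  gauss_integral (S_integrand phi F z).

(* gauss_integral is total (with a junk value on non-integrable functions),   *)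
(* so the convergence of the defining integral is required separately.        *)
Definition S_bounded (phi : Cn R n -> C R) :=
  (forall F z, in_fock F -> gauss_integrable (S_integrand phi F z)) /\
  bounded_linear_on_fock (S_op phi).

(* (x - (i/2) z)^2 for the bilinear square *)
Definition shifted_sq (x : Rn R n) z : C R :=
  \sum_j ((tnth x j)%:C - (0 +i* 1) / 2 * z ord0 j) ^+ 2.

End Fock_space.

(* Main.v *)
Require Import Defs.
From HB Require Import structures.
From mathcomp Require Import all_boot all_order all_algebra.
From mathcomp Require Import complex.
From mathcomp Require Import all_classical all_reals all_analysis.
From mathcomp Require Import measurable_realfun.
From mathcomp Require Import ring lra.
Set Implicit Arguments.
Unset Strict Implicit.
Unset Printing Implicit Defensive.
Import Order.TTheory GRing.Theory Num.Theory.
Import numFieldNormedType.Exports.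
Import ComplexField.Normc.
Local Open Scope classical_set_scope.
Local Open Scope ring_scope.
Local Open Scope complex_scope.

(** For a real number [a], the operator
    [W_a F(z) = exp(a (z_1 + ... + z_n) - n a^2 / 2) F(z - (a, ..., a))]
    is an isometry of the Fock space, because [|W_a F(z)|^2 e^(-|z|^2)] is the
    translate of [|F(z)|^2 e^(-|z|^2)].  The kernel [phi(z - conj w)] does not
    change when [z] and [w] are both translated by a real vector, so [S_phi]
    commutes with every [W_a] ([S_op_weyl]).

    The isometries [W_k], [k = 0, 1, 2, ...], push the mass of a function off
    to infinity, so a compact operator [T] commuting with them vanishes: if
    [T (W_k F) = W_k (T F)] converges along a subsequence to [G], then [G = 0],
    since [W_k (T F)] tends to zero for a weighted norm whose weight decays in
    the first real direction ([weyl_weakly_null], by dominated convergence);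
    hence [||T F|| = ||W_k (T F)||] tends to zero and [T F = 0]
    ([compact_weyl_commuting_eq0]).

    It remains to evaluate [S_phi F = 0] at the origin for
    [F(w) = conj (phi(- conj w))], which lies in the Fock space by reflection
    invariance of the Lebesgue measure: the integrand of [S_phi F(0)] is
    [|F|^2], so [||F||^2 = 0] and [phi = 0] ([S_op_refl_at0]).

    The norm of an entire function being zero forces the function to vanish
    everywhere because cubes have positive measure ([weighted_sqnorm_eq0]);
    and continuous functions on [C^n] are measurable for the product
    sigma-algebra because an open set is a countable union of rational boxes
    ([open_pointCn_measurable]). *)

(** * Measure-preserving maps of R^n *)

Section measure_preserving.

(** [f] is measurable and [mu] is invariant under it. *)
Definition measure_preserving (R : realType) d (T : measurableType d)
    (mu : set T -> \bar R) (f : T -> T) : Prop :=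
  measurable_fun [set: T] f /\
  forall A, measurable A -> mu (f @^-1` A) = mu A.

Context (R : realType).

Lemma measure_preserving_prod d1 d2 (T1 : measurableType d1)
    (T2 : measurableType d2) (m1 : {sigma_finite_measure set T1 -> \bar R})
    (m2 : {sigma_finite_measure set T2 -> \bar R})
    (f : T1 -> T1) (g : T2 -> T2) :
  measure_preserving m1 f -> measure_preserving m2 g ->
  measure_preserving (m1 \x m2)%E (fun p => (f p.1, g p.2)).
Proof.
move=> [mf fE] [mg gE].
pose h : T1 * T2 -> T1 * T2 := fun p => (f p.1, g p.2).
have mh : measurable_fun [set: _] h.
  by apply: measurable_fun_pair; exact: measurableT_comp.
split=> // X mX.
pose m' : {measure set _ -> \bar R} :=
  measure_function_pushforward__canonical__measure_function_Measure
    (m1 \x m2)%E mh.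
rewrite -[LHS]/(m' X); apply/esym.
apply: product_measure_unique => // A B mA mB.
rewrite /m'/= /pushforward.
rewrite -[X in _ = (X * _)%E]fE// -[X in _ = (_ * X)%E]gE//.
rewrite -product_measure1E//.
  by rewrite -[X in measurable X]setTI; exact: mf.
by rewrite -[X in measurable X]setTI; exact: mg.
Qed.

Lemma measure_preserving_shift (a : R) :
  measure_preserving (@lebesgue_measure R)
    ((fun x : R => x + a) : measurableTypeR R -> measurableTypeR R).
Proof.
pose h : measurableTypeR R -> measurableTypeR R := (fun x : R => x + a).
have mh : measurable_fun [set: _] h by exact: measurable_funD.
split=> // A mA.
pose m' : {measure set (measurableTypeR R) -> \bar R} :=
  measure_function_pushforward__canonical__measure_function_Measure
    (@lebesgue_measure R) mh.
rewrite -[LHS]/(m' A); apply/esym.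
apply: lebesgue_measure_unique => //= _ [[b c]] _ <-.
rewrite /pushforward (_ : h @^-1` _ = `]b - a, c - a]%classic).
  rewrite !lebesgue_measure_itv/= !lte_fin ltrD2r.
  by case: ifP => // _; rewrite -!EFinB; congr EFin; ring.
by apply/seteqP; split=> x /=; rewrite !in_itv/= ltrBlDr lerBrDr.
Qed.

Lemma measure_preserving_opp :
  measure_preserving (@lebesgue_measure R)
    ((fun x : R => - x) : measurableTypeR R -> measurableTypeR R).
Proof.
split; first exact: measurable_funN.
by move=> A mA; exact: lebesgue_measureN.
Qed.

(** A measure-preserving map of the line, applied to all the coordinates,
    preserves the Lebesgue measure of [R^n]. *)
Lemma measure_preserving_map_tuple n
    (f : measurableTypeR R -> measurableTypeR R) :
  measure_preserving (@lebesgue_measure R) f ->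
  measure_preserving (lebesgueRn R n) (map_tuple f).
Proof.
move=> ff; elim: n => [|n IH].
  have -> : @map_tuple 0 _ _ f = id.
    by apply/funext => t; rewrite (tuple0 t); exact/val_inj.
  by split.
have mm : measurable_fun [set: _] (@map_tuple n.+1 _ _ f).
  apply/measurable_fun_tnthP => i.
  rewrite (_ : _ \o _ = f \o (fun t => tnth t i)); last first.
    by apply/funext => t /=; rewrite tnth_map.
  by apply: measurableT_comp; [exact: ff.1 | exact: measurable_tnth].
split=> // A mA; rewrite /= /lebesgueRnS /pushforward.
rewrite -[RHS](measure_preserving_prod ff IH).2; last first.
  by rewrite -[X in measurable X]setTI; exact: measurable_consRn.
congr (_ _); apply/seteqP; split => -[x t] /=; rewrite /consRn/=;
 by congr A; apply/val_inj.
Qed.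

End measure_preserving.

Section change_of_variables.
Context d (T : measurableType d) (R : realType).
Variable mu : {measure set T -> \bar R}.
Variable f : T -> T.
Hypothesis fmu : measure_preserving mu f.

Lemma ge0_integral_measure_preserving (D : set T) (g : T -> \bar R) :
  measurable D -> measurable_fun [set: T] g -> (forall x, 0 <= g x)%E ->
  (\int[mu]_(x in f @^-1` D) g (f x) = \int[mu]_(x in D) g x)%E.
Proof.
move=> mD mg g0; have [mf fE] := fmu.
transitivity (\int[pushforward mu f]_(x in D) g x)%E.
  by rewrite (ge0_integral_pushforward mf)//; exact: measurable_funTS.
by apply: eq_measure_integral => A mA _; exact: fE.
Qed.

Lemma Rintegral_measure_preserving (g : T -> R) :
  measurable_fun [set: T] g -> mu.-integrable [set: T] (EFin \o (g \o f)) ->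
  \int[mu]_(x in [set: T]) g (f x) = \int[mu]_(x in [set: T]) g x.
Proof.
move=> mg ig; have [mf fE] := fmu; congr fine.
transitivity (\int[pushforward mu f]_(x in [set: T]) (g x)%:E)%E.
  by rewrite (integral_pushforward mf)//=; exact/measurable_EFinP.
by apply: eq_measure_integral => A mA _; exact: fE.
Qed.

Lemma cintegral_measure_preserving (g : T -> C R) :
  cmeasurable g -> cintegrable mu (g \o f) ->
  cintegral mu (g \o f) = cintegral mu g.
Proof.
move=> [mr mi] [ir ii]; rewrite /cintegral /=.
by congr (_ +i* _); exact: Rintegral_measure_preserving.
Qed.

End change_of_variables.

(** * Measurability of continuous functions on C^n *)

Section complex_measurability.
Context (R : realType) (n : nat).

Lemma normc_le_ReIm (a : C R) : normc a <= `|complex.Re a| + `|complex.Im a|.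
Proof.
case: a => x y /=.
rewrite -[leRHS]ger0_norm ?addr_ge0// -sqrtr_sqr ler_wsqrtr//.
rewrite sqrrD !real_normK ?num_real// addrAC lerDl.
by rewrite mulrn_wge0 ?mulr_ge0.
Qed.

Lemma Re_le_normc (a : C R) : `|complex.Re a| <= normc a.
Proof.
case: a => x y /=; rewrite -sqrtr_sqr ler_wsqrtr// lerDl sqr_ge0 //.
Qed.

Lemma Im_le_normc (a : C R) : `|complex.Im a| <= normc a.
Proof.
case: a => x y /=; rewrite -sqrtr_sqr ler_wsqrtr// lerDr sqr_ge0 //.
Qed.

Lemma sqr_normcE (a : C R) :
  normc a ^+ 2 = complex.Re a ^+ 2 + complex.Im a ^+ 2.
Proof. by case: a => x y /=; rewrite sqr_sqrtr ?addr_ge0 ?sqr_ge0. Qed.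

Lemma normC_normc (a : C R) : `|a| = (normc a)%:C.
Proof. by []. Qed.

Lemma posC_real (e : C R) : 0 < e -> e = (complex.Re e)%:C /\ 0 < complex.Re e.
Proof. by case: e => x y; rewrite ltcE /= => /andP[/eqP -> ->]. Qed.

(** The radii of the balls of [C^n] are positive elements of [C], hence real:
    the neighbourhoods are those of the real-valued sup norm. *)
Lemma nbhs_CnP (z : Cn R n) (U : set (Cn R n)) : nbhs z U <->
  exists2 e : R, 0 < e &
    forall w : Cn R n, (forall j, normc (z ord0 j - w ord0 j) < e) -> U w.
Proof.
split=> [/nbhs_ballP[e /= /posC_real[-> e0] eU]|[e e0 eU]].
  exists (complex.Re e) => // w zw; apply: eU.
  split => [|i j]; first by rewrite ltcR.
  by rewrite (ord1 i) /ball/= /ball_ normC_normc ltcR.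
apply/nbhs_ballP; exists (e%:C) => /=; first by rewrite ltcR.
move=> w [_ zw]; apply: eU => j; have := zw ord0 j.
by rewrite /ball/= /ball_ normC_normc ltcR.
Qed.

Lemma nbhs_CP (z : C R) (U : set (C R)) : nbhs z U <->
  exists2 e : R, 0 < e & forall w : C R, normc (z - w) < e -> U w.
Proof.
split=> [/nbhs_ballP[e /= /posC_real[-> e0] eU]|[e e0 eU]].
  exists (complex.Re e) => // w zw; apply: eU.
  by rewrite /ball/= normC_normc ltcR.
apply/nbhs_ballP; exists (e%:C) => /=; first by rewrite ltcR.
by move=> w zw; apply: eU; have := zw; rewrite /ball/= normC_normc ltcR.
Qed.

Lemma continuous_Re : continuous (fun z : C R => complex.Re z : R).
Proof.
move=> z; have FF := nbhs_filter (z : C R).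
apply/(@cvgrPdist_lt _ _ _ (nbhs (z : C R)) FF) => e e0.
apply/nbhs_CP; exists e => // w.
by apply: le_lt_trans; rewrite -raddfB; exact: Re_le_normc.
Qed.

Lemma continuous_Im : continuous (fun z : C R => complex.Im z : R).
Proof.
move=> z; have FF := nbhs_filter (z : C R).
apply/(@cvgrPdist_lt _ _ _ (nbhs (z : C R)) FF) => e e0.
apply/nbhs_CP; exists e => // w.
by apply: le_lt_trans; rewrite -raddfB; exact: Im_le_normc.
Qed.

(** The open cube of [R^n x R^n] with rational centre [q.1] and half-side
    [1 / (q.2 + 1)]. *)
Definition rational_box (q : {ffun 'I_n -> rat} * {ffun 'I_n -> rat} * nat) :
    set (Rn R n * Rn R n) :=
  [set p | forall j, `|tnth p.1 j - ratr (q.1.1 j)| < q.2.+1%:R^-1 /\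
                     `|tnth p.2 j - ratr (q.1.2 j)| < q.2.+1%:R^-1 ].

Lemma measurable_tnth_dist (a e : R) (j : 'I_n) :
  measurable [set t : Rn R n | `|tnth t j - a| < e].
Proof.
have -> : [set t : Rn R n | `|tnth t j - a| < e] =
    (tnth (T:=measurableTypeR R))^~ j @^-1` `]a - e, a + e[%classic.
  by apply/seteqP; split=> t /=; rewrite in_itv/= ltr_distl.
rewrite -[X in measurable X]setTI; apply: measurable_tnth => //.
Qed.

Lemma measurable_forall_ord d (T : measurableType d) (A : 'I_n -> set T) :
  (forall j, measurable (A j)) -> measurable [set p | forall j, A j p].
Proof.
move=> mA.
have -> : [set p | forall j, A j p] = \bigcap_(j in [set: 'I_n]) A j.
  by apply/seteqP; split=> p h j => [_|]; exact: h.
apply: fin_bigcap_measurable => //; exact: finite_finset.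
Qed.

Lemma measurable_rational_box q : measurable (rational_box q).
Proof.
apply: measurable_forall_ord => j; apply: measurableI.
  have := measurable_tnth_dist (ratr (q.1.1 j)) q.2.+1%:R^-1 j.
  by move=> /(@measurable_fst _ _ (Rn R n) (Rn R n) measurableT); rewrite setTI.
have := measurable_tnth_dist (ratr (q.1.2 j)) q.2.+1%:R^-1 j.
by move=> /(@measurable_snd _ _ (Rn R n) (Rn R n) measurableT); rewrite setTI.
Qed.

Lemma open_pointCn_measurable (U : set (Cn R n)) :
  open U -> measurable (@pointCn R n @^-1` U).
Proof.
move=> oU.
have -> : @pointCn R n @^-1` U =
    \bigcup_q (if `[< rational_box q `<=` @pointCn R n @^-1` U >]
                then rational_box q else set0).
  apply/seteqP; split=> [p Up|p [q _]]; last by case: asboolP => // + ?; exact.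
  have /nbhs_CnP[e e0 eU] : nbhs (pointCn p) U by exact: open_nbhs_nbhs.
  (* two points of the box differ by less than [2 / (k + 1)] in each of the
     real and imaginary parts, hence by less than [e] *)
  have [k ke] : exists k, k.+1%:R^-1 < e / 4.
    have /cvgrPdist_lt/(_ (e/4)) := @cvg_harmonic R.
    case=> [|k _ /(_ k)]; first by rewrite divr_gt0.
    rewrite sub0r normrN /harmonic/= => /(_ (leqnn k)) h.
    by exists k; apply: le_lt_trans h; rewrite ler_norm.
  have rt (x : R) : {q : rat | `|x - ratr q| < k.+1%:R^-1}.
    apply: cid.
    have [|q] := @rat_in_itvoo R (x - k.+1%:R^-1) (x + k.+1%:R^-1).
      by rewrite ltrBlDr -addrA ltrDl -mulr2n pmulrn_rgt0 ?invr_gt0.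
    by rewrite in_itv/= -ltr_distl distrC => xq; exists q.
  pose q1 := [ffun j => sval (rt (tnth p.1 j))].
  pose q2 := [ffun j => sval (rt (tnth p.2 j))].
  have bp : rational_box (q1, q2, k) p.
    move=> j /=; rewrite !ffunE.
    split; first exact: (svalP (rt (tnth p.1 j))).
    exact: (svalP (rt (tnth p.2 j))).
  exists (q1, q2, k) => //; case: asboolP => // -[] p' bp'.
  apply: eU => j; rewrite !mxE; apply: le_lt_trans (normc_le_ReIm _) _ => /=.
  have [a1 a2] := bp j; have [b1 b2] := bp' j.
  move: a1 a2 b1 b2 ke => /=; rewrite !ltr_norml /=.
  set ik := _^-1.
  move: (tnth p.1 j) (tnth p.2 j) (tnth p'.1 j) (tnth p'.2 j) => /= x y x' y'.
  move=> /andP[? ?] /andP[? ?] /andP[? ?] /andP[? ?] ?.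
  have : `|x - x'| < e / 2 by rewrite ltr_norml; apply/andP; split; lra.
  have : `|y - y'| < e / 2 by rewrite ltr_norml; apply/andP; split; lra.
  by lra.
apply: countable_bigcupT_measurable; first exact: countableP.
by move=> q; case: ifP => _ //; exact: measurable_rational_box.
Qed.

Lemma continuous_pointCn_measurable (f : Cn R n -> R) :
  continuous f -> measurable_fun [set: _] (f \o @pointCn R n).
Proof.
move=> cf; apply: (measurability _ (RGenOpens.measurableE R)) => //.
move=> _ [_ [x [y ->]] <-]; rewrite setTI comp_preimage.
apply: open_pointCn_measurable; apply: open_comp => [z _|]; first exact: cf.
exact: itv_open.
Qed.

Lemma continuous_cmeasurable (F : Cn R n -> C R) :
  continuous F -> cmeasurable (F \o @pointCn R n).
Proof.
move=> cF; split.
  apply: (@continuous_pointCn_measurable (fun z => complex.Re (F z))) => z.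
  by apply: (@continuous_comp _ _ _ F); [exact: cF|exact: continuous_Re].
apply: (@continuous_pointCn_measurable (fun z => complex.Im (F z))) => z.
by apply: (@continuous_comp _ _ _ F); [exact: cF|exact: continuous_Im].
Qed.

End complex_measurability.

(** * Vanishing of continuous functions of zero norm *)

Section positivity.
Context (R : realType).

Lemma lebesgueRn_cube_gt0 n (c : 'I_n -> R) (e : R) : 0 < e ->
  (0 < lebesgueRn R n [set t : Rn R n | (forall j, `|tnth t j - c j| < e)%R])%E.
Proof.
move=> e0; elim: n c => [|n IH] c.
  rewrite /= diracE mem_set ?lte_fin//= => -[] //.
rewrite /= /lebesgueRnS /pushforward.
have -> : @consRn R n @^-1` [set t | forall j, `|tnth t j - c j| < e] =
    `]c ord0 - e, c ord0 + e[%classic `*`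
    [set t | forall j, `|tnth t j - c (lift ord0 j)| < e].
  apply/seteqP; split=> -[x t] /=; rewrite in_itv/= -ltr_distl.
    move=> h; split=> [|j]; first by have := h ord0; rewrite tnth0.
    by have := h (lift ord0 j); rewrite tnthS.
  move=> [h0 hS] j; have [k ->|->] := unliftP ord0 j; first by rewrite tnthS.
  by rewrite tnth0.
rewrite product_measure1E//; last first.
  by apply: measurable_forall_ord => j; exact: measurable_tnth_dist.
apply: mule_gt0 => //.
rewrite -[X in (_ < X)%E]/
  (lebesgue_measure `](c ord0 - e), (c ord0 + e)[%classic).
rewrite lebesgue_measure_itv/= lte_fin ifT; last by lra.
by rewrite -EFinB lte_fin; lra.
Qed.

Context (n : nat).
Implicit Types F : Cn R n -> C R.

(** The integrand of [fock_sqnorm F]: the density of [|F|^2 d lambda], [lambda]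
    the Gaussian measure, with respect to the Lebesgue measure. *)
Definition sqdens F (p : Rn R n * Rn R n) : R :=
  normc (F (pointCn p)) ^+ 2 * gauss_density (pointCn p).

Lemma gauss_density_gt0 (z : Cn R n) : 0 < gauss_density z.
Proof. by rewrite mulr_gt0 ?expR_gt0// invr_gt0 exprn_gt0// pi_gt0. Qed.

Lemma sqdens_ge0 F p : 0 <= sqdens F p.
Proof. by rewrite mulr_ge0 ?sqr_ge0// ltW// gauss_density_gt0. Qed.

Lemma measurable_gauss_density :
  measurable_fun [set: Rn R n * Rn R n] (fun p => gauss_density (pointCn p)).
Proof.
apply: measurable_funM => //; apply: measurableT_comp => //.
apply: measurable_funN; apply: measurable_sum => j.
under eq_fun do rewrite mxE sqr_normcE /=.
apply: measurable_funD; apply: measurable_funX.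
  apply: (measurableT_comp (f := @tnth _ _ ^~ j)) => //.
  exact: measurable_tnth.
apply: (measurableT_comp (f := @tnth _ _ ^~ j)) => //.
exact: measurable_tnth.
Qed.

Lemma measurable_sqdens F : continuous F -> measurable_fun [set: _] (sqdens F).
Proof.
move=> /continuous_cmeasurable[mr mi].
apply: measurable_funM; last exact: measurable_gauss_density.
under eq_fun do rewrite sqr_normcE.
by apply: measurable_funD; apply: measurable_funX.
Qed.

Lemma fock_sqnormE F :
  fock_sqnorm F = (\int[lebesgueCn R n]_p (sqdens F p)%:E)%E.
Proof. by []. Qed.

Lemma fock_sqnorm_ge0 F : (0 <= fock_sqnorm F)%E.
Proof. by apply: integral_ge0 => p _; rewrite lee_fin sqdens_ge0. Qed.

(** The integrand vanishes outside a negligible set, which would contain a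
    cube around any point where [F] does not vanish. *)
Lemma weighted_sqnorm_eq0 (w : Rn R n * Rn R n -> R) F :
  measurable_fun [set: _] w -> (forall p, 0 < w p) -> continuous F ->
  (\int[lebesgueCn R n]_p (w p * sqdens F p)%:E)%E = 0%E -> F = fun=> 0.
Proof.
move=> mw w0 cF F0; apply/funext => z; apply/eqP/negPn/negP => Fz.
have mG : measurable_fun [set: _] (fun p => (w p * sqdens F p)%:E).
  apply/measurable_EFinP; apply: measurable_funM => //.
  exact: measurable_sqdens.
have : (\int[lebesgueCn R n]_p `|(w p * sqdens F p)%:E| = 0)%E.
  rewrite -[RHS]F0; apply: eq_integral => p _.
  by rewrite gee0_abs// lee_fin mulr_ge0 ?sqdens_ge0// ltW.
move=> /(ae_eq_integral_abs _ measurableT mG)[N [mN N0 sN]].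
have /nbhs_CnP[e e0 eF] : nbhs z [set w | F w != 0].
  apply: (cF z [set v : C R | v != 0]); apply/nbhs_CP; exists (normc (F z)).
    rewrite lt_def (le_trans _ (Re_le_normc _))// andbT.
    by apply: contra_neq Fz => /eq0_normc.
  by move=> v /=; apply: contraTneq => ->; rewrite subr0 ltxx.
pose B : set (Rn R n * Rn R n) :=
  [set t | forall j, `|tnth t j - complex.Re (z ord0 j)| < e / 2] `*`
  [set t | forall j, `|tnth t j - complex.Im (z ord0 j)| < e / 2].
have BN : B `<=` N.
  move=> p [p1 p2]; apply: sN => /= /(_ I) [] /eqP.
  rewrite mulf_eq0 (gt_eqF (w0 _)) /= mulf_eq0.
  rewrite (gt_eqF (gauss_density_gt0 _)) orbF sqrf_eq0 => /eqP/eq0_normc.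
  apply/eqP; apply: eF => j; apply: le_lt_trans (normc_le_ReIm _) _.
  rewrite mxE -normrN -[X in _ + X]normrN -!raddfN !opprB !raddfB/=.
  by have := p1 j; have := p2 j; rewrite /=; lra.
have e2 : 0 < e / 2 by lra.
have mq (c : 'I_n -> R) :
    measurable [set t : Rn R n | forall j, `|tnth t j - c j| < e / 2].
  by apply: measurable_forall_ord => j; exact: measurable_tnth_dist.
have : (lebesgueCn R n B <= 0)%E.
  by rewrite -N0; apply: le_measure => //; rewrite inE//; exact: measurableX.
rewrite -[lebesgueCn R n B]/((lebesgueRn R n \x lebesgueRn R n)%E B).
rewrite product_measure1E//; apply/negP; rewrite -ltNge.
by apply: mule_gt0; exact: lebesgueRn_cube_gt0.
Qed.

Lemma fock_sqnorm_eq0 F : continuous F -> fock_sqnorm F = 0%E -> F = fun=> 0.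
Proof.
move=> cF F0; apply: (@weighted_sqnorm_eq0 (fun=> 1) F) => //.
by rewrite -[RHS]F0; apply: eq_integral => p _; rewrite mul1r.
Qed.

End positivity.

(** * The complex exponential *)

Section complex_exponential.
Context (R : realType).

Lemma cexp0 : cexp 0 = 1 :> C R.
Proof. by rewrite /cexp/= expR0 cos0 sin0 mul1r. Qed.

Lemma cexpD (a b : C R) : cexp (a + b) = cexp a * cexp b.
Proof.
case: a b => [x y] [u v]; rewrite /cexp /= expRD cosD sinD.
apply/eqP; rewrite eq_complex /= !mul0r !subr0 !addr0.
by apply/andP; split; apply/eqP; ring.
Qed.

Lemma normc_cexp (a : C R) : normc (cexp a) = expR (complex.Re a).
Proof.
rewrite /cexp normcM /= expr0n /= addr0 cos2Dsin2 sqrtr1 mulr1 sqrtr_sqr.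
by rewrite ger0_norm // expR_ge0.
Qed.

Let sin_cos_bound (y : R) : 0 <= y ->
  [/\ `|sin y| <= y, `|cos y - 1| <= y ^+ 2 & y <= 1 -> `|sin y - y| <= y ^+ 2].
Proof.
have csin (a b : R) : {within `[a, b], continuous (@sin R)}.
  by apply: continuous_subspaceT; exact: continuous_sin.
have ccos (a b : R) : {within `[a, b], continuous (@cos R)}.
  by apply: continuous_subspaceT; exact: continuous_cos.
have sinb (x : R) : 0 <= x -> `|sin x| <= x.
  move=> x0.
  have [c _] := MVT_segment x0 (fun y _ => is_derive_sin y) (csin _ _).
  rewrite sin0 !subr0 => ->; rewrite normrM (ger0_norm x0) ler_piMl//.
  by rewrite ler_norml cos_geN1 cos_le1.
have cosb (x : R) : 0 <= x -> `|cos x - 1| <= x ^+ 2.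
  move=> x0; have [c] := MVT_segment x0 (fun y _ => is_derive_cos y) (ccos _ _).
  rewrite in_itv/= => /andP[c0 cx].
  rewrite cos0 !subr0 => ->; rewrite normrM normrN (ger0_norm x0) expr2.
  by apply: ler_wpM2r => //; apply: le_trans cx; exact: sinb.
move=> y0; split; [exact: sinb|exact: cosb|move=> y1].
have dsin (x : R) : is_derive x 1 (sin - id) (cos x - 1) by exact: is_deriveB.
have [|c] := MVT_segment y0 (fun x _ => dsin x).
  apply: continuous_subspaceT => x.
  by apply: cvgB; [exact: continuous_sin|exact: cvg_id].
rewrite in_itv/= => /andP[c0 cy].
rewrite !fctE sin0 !subr0 => ->; rewrite normrM (ger0_norm y0) expr2.
apply: ler_wpM2r => //; apply: le_trans (cosb _ c0) _.
by rewrite expr2; nra.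
Qed.

Lemma sin_le_norm (y : R) : `|sin y| <= `|y|.
Proof.
have [y0|/ltW y0] := leP 0 y.
  by rewrite (ger0_norm y0); case: (sin_cos_bound y0).
have ny0 : 0 <= - y by rewrite oppr_ge0.
by case: (sin_cos_bound ny0) => + _ _; rewrite sinN normrN (ler0_norm y0).
Qed.

Lemma cos_sub1_le (y : R) : `|cos y - 1| <= y ^+ 2.
Proof.
have [y0|/ltW y0] := leP 0 y; first by case: (sin_cos_bound y0).
have ny0 : 0 <= - y by rewrite oppr_ge0.
by case: (sin_cos_bound ny0) => _ + _; rewrite cosN sqrrN.
Qed.

Lemma sin_subid_le (y : R) : `|y| <= 1 -> `|sin y - y| <= y ^+ 2.
Proof.
have [y0|/ltW y0] := leP 0 y.
  by rewrite (ger0_norm y0); case: (sin_cos_bound y0).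
have ny0 : 0 <= - y by rewrite oppr_ge0.
case: (sin_cos_bound ny0) => _ _ h; rewrite (ler0_norm y0) => /h.
by rewrite sinN sqrrN -opprD normrN.
Qed.

(** The upper bound comes from [1 - x <= exp(- x)], which gives
    [exp x <= 1 / (1 - x)]. *)
Lemma expR_sub1id_le (x : R) : `|x| <= 1 / 2 -> `|expR x - 1 - x| <= 2 * x ^+ 2.
Proof.
rewrite ler_norml => /andP[x1 x2].
have h1 := expR_ge1Dx x; have h2 := expR_ge1Dx (- x).
have h3 : expR x * expR (- x) = 1 by rewrite -expRD subrr expR0.
have h4 := expR_gt0 x.
rewrite ler_norml; apply/andP; split; first by nra.
have h5 : expR x * (1 - x) <= 1 by rewrite -[leRHS]h3 ler_pM2l.
have : (expR x - 1 - x) * (1 - x) <= x ^+ 2 by nra.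
nra.
Qed.

(** The second-order Taylor bound which yields complex differentiability at
    the origin, and everywhere by [cexpD]. *)
Lemma cexp_sub1id_le (h : C R) : normc h <= 1 / 2 ->
  normc (cexp h - 1 - h) <= 4 * normc h ^+ 2.
Proof.
move=> h2; have hx := le_trans (Re_le_normc h) h2.
have hy := le_trans (Im_le_normc h) h2.
rewrite sqr_normcE; apply: le_trans (normc_le_ReIm _) _.
case: h {h2} hx hy => x y /= hx hy; rewrite /cexp/= !mul0r ?oppr0 !addr0 ?subr0.
have e1 := expR_sub1id_le hx.
have y1 : `|y| <= 1 by lra.
have s1 := sin_subid_le y1; have c1 := cos_sub1_le y; have s2 := sin_le_norm y.
have c2 : `|cos y| <= 1 by rewrite ler_norml cos_geN1 cos_le1.
have r1 : `|expR x * cos y - 1 - x| <= 2 * x ^+ 2 + 2 * y ^+ 2.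
  have -> : expR x * cos y - 1 - x =
      (expR x - 1 - x) * cos y + (1 + x) * (cos y - 1).
    by ring.
  apply: le_trans (ler_normD _ _) _; rewrite !normrM.
  have := ler_normD 1 x; rewrite normr1 => x1.
  apply: lerD.
    by apply: le_trans (ler_piMr _ _) e1.
  by apply: ler_pM => //; lra.
have r2 : `|expR x * sin y - y| <= 2 * x ^+ 2 + 2 * y ^+ 2.
  have -> : expR x * sin y - y =
      (expR x - 1 - x) * sin y + x * sin y + (sin y - y).
    by ring.
  apply: le_trans (ler_normD _ _) _.
  apply: le_trans (lerD (ler_normD _ _) s1) _; rewrite !normrM.
  have a1 : `|expR x - 1 - x| * `|sin y| <= 2 * x ^+ 2 * `|y| by exact: ler_pM.
  have a2 : `|x| * `|sin y| <= `|x| * `|y| by exact: ler_wpM2l.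
  have a3 : 2 * (`|x| * `|y|) <= x ^+ 2 + y ^+ 2.
    by rewrite -(real_normK (num_real x)) -(real_normK (num_real y));
    have := sqr_ge0 (`|x| - `|y|); nra.
  have a4 : 2 * x ^+ 2 * `|y| <= x ^+ 2.
    have := sqr_ge0 x; nra.
  have := sqr_ge0 x; have := sqr_ge0 y; lra.
lra.
Qed.

Lemma differentiable_cexp (z : C R) : differentiable (@cexp R) z.
Proof.
apply/derivable1_diffP/cvg_ex; exists (cexp z).
have FF : Filter (0 : C R)^' := dnbhs_filter _.
apply/(@cvgrPdist_lt _ _ _ _ FF) => e /posC_real[-> e0].
have c0 : 0 < normc (cexp z) by rewrite normc_cexp expR_gt0.
apply/nbhs_CP.
(* the difference quotient is within [4 |exp z| |h|] of [exp z] *)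
exists (Num.min (1/2) (complex.Re e / (8 * normc (cexp z)))).
  by rewrite lt_min divr_gt0//= divr_gt0// mulr_gt0.
move=> h; rewrite lt_min sub0r normcN => /andP[h1 h2] h0.
rewrite normC_normc ltcR.
have -> : (@cexp R \o shift z) (h *: (1 : C R)) = cexp z * cexp h.
  by rewrite -[h *: _]/(h * 1) mulr1 /= addrC cexpD.
have -> : cexp z - h^-1 *: (cexp z * cexp h - cexp z) =
    - (cexp z * (cexp h - 1 - h) * h^-1).
  rewrite -[h^-1 *: _]/(h^-1 * _).
  have : h * h^-1 = 1 by rewrite divff.
  set k := h^-1; move: (cexp z) (cexp h) => a b hk.
  by transitivity (a * (h * k) - k * (a * b - a)); [rewrite hk mulr1|ring].
rewrite normcN normcM (normcM (cexp z)) normcV.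
have nh : 0 < normc h.
  rewrite lt_def (le_trans _ (Re_le_normc _))// andbT.
  by apply: contra_neq h0 => /eq0_normc.
rewrite ltr_pdivrMr//.
have bnd : normc (cexp z) * normc (cexp h - 1 - h) <=
    normc (cexp z) * (4 * normc h ^+ 2).
  by rewrite ler_wpM2l ?(ltW c0)//; apply: cexp_sub1id_le; exact: ltW.
apply: (le_lt_trans bnd).
rewrite expr2 !mulrA ltr_pM2r//.
move: h2; rewrite ltr_pdivlMr ?mulr_gt0// => h2.
have := mulr_gt0 nh c0; nra.
Qed.

End complex_exponential.

(** * The reflection F(w) -> conj (F(- conj w)) *)

Section differentiable_dist.
Context (K : numFieldType) (V W : normedModType K).

Lemma differentiable_near_le (f : V -> W) (x : V) : differentiable f x ->
  forall e, 0 < e -> \forall h \near (0 : V),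
    `|f (h + x) - (f x + 'd f x h)| <= e * `|h|.
Proof. by move=> df; apply/eqaddoP; exact: diff_locally. Qed.

Lemma near_le_differentiable (f : V -> W) (df : {linear V -> W}) (x : V) :
  continuous df ->
  (forall e, 0 < e -> \forall h \near (0 : V),
    `|f (h + x) - (f x + df h)| <= e * `|h|) ->
  differentiable f x.
Proof.
move=> dfc dfP.
have dfE : f \o shift x = cst (f x) + df +o_ 0 id by apply/eqaddoP.
by apply/diff_locallyP; rewrite (diff_unique dfc dfE).
Qed.

End differentiable_dist.

Section reflection.
Context (R : realType) (n : nat).

(** The reflection [x + i y -> - x + i y] of [C^n]. *)
Definition reflCn (w : Cn R n) : Cn R n := - conjCn w.

(** The conjugation of functions on [C^n] induced by [reflCn]. *)
Definition fock_refl (F : Cn R n -> C R) (w : Cn R n) : C R := (F (reflCn w))^*.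

Lemma conjCD (a b : C R) : ((a + b)^*)%C = (a^*)%C + (b^*)%C :> C R.
Proof. exact: raddfD. Qed.

Lemma conjCN (a : C R) : ((- a)^*)%C = - (a^*)%C :> C R.
Proof. exact: raddfN. Qed.

Lemma conjCM (a b : C R) : ((a * b)^*)%C = (a^*)%C * (b^*)%C :> C R.
Proof. exact: rmorphM. Qed.

Lemma reflCnD : {morph reflCn : u v / u + v}.
Proof. by move=> u v; apply/rowP => j; rewrite !mxE conjCD opprD. Qed.

Lemma reflCnZ (a : C R) (u : Cn R n) : reflCn (a *: u) = a^* *: reflCn u.
Proof.
by apply/rowP => j; rewrite !mxE conjCM -mulrN.
Qed.

Lemma reflCnK : involutive reflCn.
Proof.
move=> u; apply/rowP => j; rewrite !mxE -conjCN opprK (ord1 0); exact: conjcK.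
Qed.

Lemma norm_reflCn (u : Cn R n) : `|reflCn u| = `|u|.
Proof.
rewrite normrN !/Num.norm /= !mx_normE; congr (_%:num).
apply: eq_bigr => i _; apply/val_inj => /=.
by rewrite mxE (ord1 i.1) normcJ.
Qed.

Lemma normc_conj (a : C R) : normc (a^*)%C = normc a.
Proof. by case: a => x y /=; rewrite sqrrN. Qed.

Lemma continuous_conj : continuous (fun a : C R => (a^*)%C : C R).
Proof.
move=> z U /nbhs_CP[e e0 eU]; apply/nbhs_CP; exists e => // w zw.
by apply: eU; rewrite -conjCN -conjCD normc_conj.
Qed.

Lemma continuous_reflCn : continuous reflCn.
Proof.
move=> z U /nbhs_CnP[e e0 eU]; apply/nbhs_CnP; exists e => // w zw.
by apply: eU => j; rewrite !mxE -opprD -conjCN -conjCD normcN normc_conj.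
Qed.

(** The reflection and the outer conjugation are both antilinear, so the
    conjugated differential is again linear over [C]. *)
Lemma differentiable_fock_refl (F : Cn R n -> C R) (w : Cn R n) :
  differentiable F (reflCn w) -> differentiable (fock_refl F) w.
Proof.
move=> dF; pose d (v : Cn R n) : C R := ('d F (reflCn w) (reflCn v))^*.
have dlin : linear d.
  move=> a u v; rewrite /d reflCnD reflCnZ linearD linearZ /=.
  by rewrite conjCD -[_ *: _]/((a^*)%C * _) conjCM conjcK.
pose dM := GRing.isLinear.Build _ _ _ _ _ dlin.
pose dL : {linear Cn R n -> C R} := HB.pack d dM.
have dc : continuous dL.
  move=> v; apply: (@continuous_comp _ _ _ ('d F (reflCn w) \o reflCn)).
    apply: continuous_comp; first exact: continuous_reflCn.
    by apply: diff_continuous.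
  exact: continuous_conj.
apply: (near_le_differentiable dc) => e e0.
have r0 : reflCn 0 = 0 by apply/rowP => j; rewrite !mxE raddf0 oppr0.
have h' := @continuous_reflCn 0 _; rewrite r0 in h'.
have h'' := h' _ (differentiable_near_le dF e0).
have FF := nbhs_filter (0 : Cn R n).
move: h''; apply: (@filterS _ _ FF) => v /=.
rewrite norm_reflCn; apply: le_trans.
rewrite /fock_refl /d reflCnD.
by rewrite -conjCD -conjCN -conjCD !normC_normc normc_conj.
Qed.

End reflection.

(** * Real Weyl translations of the Fock space *)

Section weyl.
Context (R : realType) (n : nat).
Implicit Types F : Cn R n -> C R.

(** The Weyl operator [W_b F(z) = e^(z . b - |b|^2 / 2) F(z - b)] for the real
    vector [b = (a, ..., a)].  Translating all the coordinates by the same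
    amount is enough for the compactness argument. *)
Definition weyl (a : R) F (z : Cn R n) : C R :=
  cexp (a%:C * (\sum_j z ord0 j) - (n%:R * a ^+ 2 / 2)%:C) *
  F (z - const_mx a%:C).

Lemma entire_weyl a F : entire F -> entire (weyl a F).
Proof.
move=> eF z.
pose f (w : Cn R n) : C R := a%:C * (\sum_j w ord0 j) - (n%:R * a ^+ 2 / 2)%:C.
pose g (w : Cn R n) : Cn R n := w - const_mx a%:C.
have df : differentiable f z.
  apply: differentiableB => //; apply: differentiableM => //.
  rewrite (_ : (fun _ => _) = \sum_(j < n) (fun w : Cn R n => w ord0 j)).
    2: by apply/funext => w; rewrite fct_sumE.
  by apply: differentiable_sum => j; exact: differentiable_coord.
have dg : differentiable g z by apply: differentiableB.
have dcf : differentiable (@cexp R \o f) z.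
  exact: (differentiable_comp df (@differentiable_cexp R (f z))).
have dFg : differentiable (F \o g) z.
  exact: (differentiable_comp dg (eF (g z))).
exact: differentiableM dcf dFg.
Qed.

(** The translation of [C^n] by [(a, ..., a)] in real coordinates: the
    imaginary parts are left unchanged. *)
Definition shiftp (a : R) (p : Rn R n * Rn R n) : Rn R n * Rn R n :=
  (map_tuple (fun x : R => x + a) p.1, p.2).

Lemma measure_preserving_shiftp a :
  measure_preserving (lebesgueCn R n) (shiftp a).
Proof.
apply: (measure_preserving_prod (g := id)); last by split.
exact/measure_preserving_map_tuple/measure_preserving_shift.
Qed.

Lemma pointCn_shiftp a p : pointCn (shiftp a p) = pointCn p + const_mx a%:C.
Proof.
apply/rowP => j; rewrite !mxE /= tnth_map; apply/eqP.
by rewrite eq_complex /= addr0 !eqxx.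
Qed.

Lemma shiftpK a : cancel (shiftp a) (shiftp (- a)).
Proof.
case=> x y; congr (_, _); apply/eq_from_tnth => j /=.
by rewrite !tnth_map addrK.
Qed.

Lemma sum_ReIm (z : Cn R n) : \sum_j z ord0 j =
  (\sum_j complex.Re (z ord0 j)) +i* (\sum_j complex.Im (z ord0 j)) :> C R.
Proof.
by apply/eqP; rewrite eq_complex /= !raddf_sum !eqxx.
Qed.

Lemma gauss_density_shift (a : R) (z : Cn R n) :
  expR (2 * a * (\sum_j complex.Re (z ord0 j)) - n%:R * a ^+ 2) *
    gauss_density z =
  gauss_density (z - const_mx a%:C).
Proof.
rewrite /gauss_density mulrCA -expRD; congr (_ * expR _).
have shiftE (j : 'I_n) : normc ((z - const_mx a%:C) ord0 j) ^+ 2 =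
    normc (z ord0 j) ^+ 2 - 2 * a * complex.Re (z ord0 j) + a ^+ 2.
  by rewrite !mxE !sqr_normcE !raddfB /= subr0; ring.
under [in RHS]eq_bigr => j _ do rewrite shiftE.
rewrite !big_split /= sumrN -mulr_sumr sumr_const card_ord -mulr_natl.
ring.
Qed.

Lemma sqdens_weyl a F p : sqdens (weyl a F) p = sqdens F (shiftp (- a) p).
Proof.
have cN : const_mx (- a)%:C = - const_mx a%:C :> Cn R n.
  by apply/rowP => j; rewrite !mxE raddfN.
rewrite /sqdens pointCn_shiftp cN.
rewrite -gauss_density_shift /weyl normcM normc_cexp exprMn -expRM_natl.
rewrite [RHS]mulrCA mulrA; congr (expR _ * _ * _).
by rewrite sum_ReIm /=; field.
Qed.

Lemma fock_sqnorm_weyl a F :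
  continuous F -> fock_sqnorm (weyl a F) = fock_sqnorm F.
Proof.
move=> cF; rewrite !fock_sqnormE.
under eq_integral do rewrite sqdens_weyl.
have := ge0_integral_measure_preserving (measure_preserving_shiftp (- a))
  measurableT (g := fun p => (sqdens F p)%:E); rewrite preimage_setT; apply.
  by apply/measurable_EFinP; exact: measurable_sqdens.
by move=> p; rewrite lee_fin sqdens_ge0.
Qed.

Lemma entire_continuous F : entire F -> continuous F.
Proof. by move=> eF z; apply: differentiable_continuous; exact: eF. Qed.

Lemma in_fock_weyl a F : in_fock F -> in_fock (weyl a F).
Proof.
move=> [eF nF]; split; first exact: entire_weyl.
by rewrite fock_sqnorm_weyl//; exact: entire_continuous.
Qed.

(** The reflection [reflCn] in real coordinates. *)
Definition reflp (p : Rn R n * Rn R n) : Rn R n * Rn R n :=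
  (map_tuple (fun x : R => - x) p.1, p.2).

Lemma measure_preserving_reflp : measure_preserving (lebesgueCn R n) reflp.
Proof.
apply: (measure_preserving_prod (g := id)); last by split.
exact/measure_preserving_map_tuple/measure_preserving_opp.
Qed.

Lemma pointCn_reflp p : pointCn (reflp p) = reflCn (pointCn p).
Proof.
apply/rowP => j; rewrite !mxE /= tnth_map; apply/eqP.
by rewrite eq_complex /= opprK !eqxx.
Qed.

Lemma gauss_density_refl (z : Cn R n) :
  gauss_density (reflCn z) = gauss_density z.
Proof.
rewrite /gauss_density; congr (_ * expR (- _)).
by apply: eq_bigr => j _; rewrite !mxE normcN normc_conj.
Qed.

Lemma sqdens_refl F p : sqdens (fock_refl F) p = sqdens F (reflp p).
Proof. by rewrite /sqdens pointCn_reflp gauss_density_refl normc_conj. Qed.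

Lemma in_fock_refl F : in_fock F -> in_fock (fock_refl F).
Proof.
move=> [eF nF]; split; first by move=> z; exact/differentiable_fock_refl/eF.
rewrite fock_sqnormE; under eq_integral do rewrite sqdens_refl.
have := ge0_integral_measure_preserving measure_preserving_reflp measurableT
  (g := fun p => (sqdens F p)%:E); rewrite preimage_setT => ->//.
  by apply/measurable_EFinP; apply: measurable_sqdens; exact: entire_continuous.
by move=> p; rewrite lee_fin sqdens_ge0.
Qed.

End weyl.

(** * Commutation of S_phi with real Weyl translations *)

Section covariance.
Context (R : realType) (n : nat).
Implicit Types F : Cn R n -> C R.

Lemma cexpR (r : R) : cexp r%:C = (expR r)%:C :> C R.
Proof. by rewrite /cexp /= cos0 sin0 mulr1. Qed.

Lemma dotCn_shift (A : C R) (z w : Cn R n) :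
  dotCn (z - const_mx A) (w - const_mx A) =
  dotCn z w - A * (\sum_j z ord0 j) - A * (\sum_j w ord0 j) + n%:R * A ^+ 2.
Proof.
rewrite /dotCn !mulr_sumr -!sumrB.
have -> : (n%:R * A ^+ 2 : C R) = \sum_(j < n) A ^+ 2.
  by rewrite sumr_const card_ord mulr_natl.
by rewrite -big_split; apply: eq_bigr => j _; rewrite !mxE /=; ring.
Qed.

Lemma sum_conjCn (w : Cn R n) :
  \sum_j conjCn w ord0 j = ((\sum_j w ord0 j)^*)%C :> C R.
Proof.
by rewrite (raddf_sum (@conjc R)); apply: eq_bigr => j _; rewrite mxE.
Qed.

Lemma addC_conj (s : C R) : s + (s^*)%C = (2 * complex.Re s)%:C.
Proof.
case: s => x y; apply/eqP; rewrite eq_complex /= subrr eqxx andbT.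
by apply/eqP; ring.
Qed.

(** The exponents of the integrand of [S_phi (W_a F) (z)] at [w], on the left,
    and of [W_a (S_phi F) (z)] at [w - (a, ..., a)], on the right; the last
    term on the right comes from the ratio of the Gaussian densities at these
    two points. *)
Lemma kernel_exponent (a : R) (z w : Cn R n) :
  a%:C * (\sum_j w ord0 j) - (n%:R * a ^+ 2 / 2)%:C + dotCn z (conjCn w) =
  a%:C * (\sum_j z ord0 j) - (n%:R * a ^+ 2 / 2)%:C +
  dotCn (z - const_mx a%:C) (conjCn w - const_mx a%:C) +
  (2 * a * (\sum_j complex.Re (w ord0 j)) - n%:R * a ^+ 2)%:C :> C R.
Proof.
rewrite dotCn_shift sum_conjCn.
have -> : (2 * a * (\sum_j complex.Re (w ord0 j)) - n%:R * a ^+ 2)%:C =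
    a%:C * (\sum_j w ord0 j + ((\sum_j w ord0 j)^*)%C) -
    n%:R * a%:C ^+ 2 :> C R.
  rewrite addC_conj sum_ReIm /= -[n%:R in RHS](rmorph_nat (real_complex R)).
  by apply/eqP; rewrite eq_complex /=; apply/andP; split; apply/eqP; ring.
ring.
Qed.

(** The integrand of [S_op phi F z] with respect to the Lebesgue measure. *)
Definition gauss_kernel (phi F : Cn R n -> C R) (z : Cn R n)
    (p : Rn R n * Rn R n) : C R :=
  S_integrand phi F z (pointCn p) * (gauss_density (pointCn p))%:C.

Lemma gauss_kernel_weyl (phi F : Cn R n -> C R) (a : R) (z : Cn R n) p :
  gauss_kernel phi (weyl a F) z p =
  cexp (a%:C * (\sum_j z ord0 j) - (n%:R * a ^+ 2 / 2)%:C) *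
  gauss_kernel phi F (z - const_mx a%:C) (shiftp (- a) p).
Proof.
have cN : const_mx (- a)%:C = - const_mx a%:C :> Cn R n.
  by apply/rowP => j; rewrite !mxE raddfN.
rewrite /gauss_kernel pointCn_shiftp cN /S_integrand /weyl.
set w := pointCn p.
have -> : conjCn (w - const_mx a%:C) = conjCn w - const_mx a%:C.
  by apply/rowP => j; rewrite !mxE conjCD conjCN conjc_real.
have -> : z - const_mx a%:C - (conjCn w - const_mx a%:C) = z - conjCn w.
  by rewrite opprB addrA subrK.
rewrite -gauss_density_shift [X in _ = _ * (_ * X)]rmorphM /= -cexpR.
have := congr1 (@cexp R) (kernel_exponent a z w).
rewrite [LHS]cexpD [RHS]cexpD (cexpD (_ - _) (dotCn _ _)) => E.
have rearrange (e1 e2 e3 e4 e5 u v g : C R) : e1 * e2 = e3 * e4 * e5 ->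
    e1 * u * e2 * v * g = e3 * (u * e4 * v * (e5 * g)).
  move=> e12; transitivity ((e1 * e2) * (u * v * g)); first by ring.
  by rewrite e12; ring.
exact: rearrange E.
Qed.

Lemma cintegrableZ (c : C R) (f : Rn R n * Rn R n -> C R) :
  cintegrable (lebesgueCn R n) f ->
  cintegrable (lebesgueCn R n) (fun p => c * f p).
Proof.
case: c => x y [fr fi].
have zi (k : R) g : (lebesgueCn R n).-integrable [set: _] (EFin \o g) ->
    (lebesgueCn R n).-integrable [set: _] (EFin \o (fun p => k * g p)).
  move=> gi; have := integrableZl measurableT k gi.
  by apply: eq_integrable => // p _.
split.
  have := integrableB measurableT (zi x _ fr) (zi y _ fi).
  apply: eq_integrable => // p _.
  by rewrite /=; case: (f p).
have := integrableD measurableT (zi x _ fi) (zi y _ fr).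
apply: eq_integrable => // p _.
by rewrite /=; case: (f p).
Qed.

Lemma cintegralZ (c : C R) (f : Rn R n * Rn R n -> C R) :
  cintegrable (lebesgueCn R n) f ->
  cintegral (lebesgueCn R n) (fun p => c * f p) =
  c * cintegral (lebesgueCn R n) f.
Proof.
case: c => x y [fr fi]; rewrite /cintegral; apply/eqP; rewrite eq_complex /=.
have zi (k : R) g : (lebesgueCn R n).-integrable [set: _] (EFin \o g) ->
    (lebesgueCn R n).-integrable [set: _] (EFin \o (fun p => k * g p)).
  move=> gi; have := integrableZl measurableT k gi.
  by apply: eq_integrable => // p _.
apply/andP; split; apply/eqP.
  rewrite -!RintegralZl// -RintegralB//; [|exact: zi|exact: zi].
  by apply: eq_Rintegral => p _; case: (f p).
rewrite -!RintegralZl// -RintegralD//; [|exact: zi|exact: zi].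
by apply: eq_Rintegral => p _; case: (f p).
Qed.

Lemma S_op_weyl (phi F : Cn R n -> C R) (a : R) : S_bounded phi -> in_fock F ->
  S_op phi (weyl a F) = weyl a (S_op phi F).
Proof.
move=> [Sint _] fF; apply/funext => z; rewrite /weyl.
set c := cexp _.
have i1 := Sint (weyl a F) z (in_fock_weyl a fF).
have i2 := Sint F (z - const_mx a%:C) fF.
have i3 := cintegrableZ c i2.
rewrite -[S_op _ _ _ in RHS]/
  (cintegral (lebesgueCn R n) (gauss_kernel phi F (z - const_mx a%:C))).
rewrite -cintegralZ//.
rewrite -[LHS]/(cintegral (lebesgueCn R n) (gauss_kernel phi (weyl a F) z)).
have E : gauss_kernel phi (weyl a F) z =
    (fun p => c * gauss_kernel phi F (z - const_mx a%:C) p) \o shiftp (- a).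
  by apply/funext => p; rewrite gauss_kernel_weyl.
have shift_mp := measure_preserving_shiftp n (- a).
rewrite [in LHS]E (cintegral_measure_preserving shift_mp)//; last by rewrite -E.
have [/measurable_int mr /measurable_int mi] := i3.
by split; exact/measurable_EFinP.
Qed.

End covariance.

(** * Escape to infinity along Weyl translations *)

Section escape.
Context (R : realType) (n : nat).
Implicit Types F G H : Cn R n -> C R.

Lemma continuous_subC F G :
  continuous F -> continuous G -> continuous (fun z => F z - G z).
Proof.
move=> cF cG z.
exact: (@continuousB (C R) (C R) (Cn R n) F G z (cF z) (cG z)).
Qed.

Lemma sqdens_le F G p :
  sqdens G p <= 2 * sqdens F p + 2 * sqdens (fun z => F z - G z) p.
Proof.
have sqr_le (u v : C R) :
    normc v ^+ 2 <= 2 * normc u ^+ 2 + 2 * normc (u - v) ^+ 2.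
  rewrite !sqr_normcE; case: u v => [a c] [b d] /=; rewrite -subr_ge0.
  have -> : 2 * (a ^+ 2 + c ^+ 2) + 2 * ((a - b) ^+ 2 + (c - d) ^+ 2) -
      (b ^+ 2 + d ^+ 2) = (2 * a - b) ^+ 2 + (2 * c - d) ^+ 2 by ring.
  by rewrite addr_ge0 ?sqr_ge0.
rewrite /sqdens.
have := ler_wpM2r (ltW (gauss_density_gt0 (pointCn p)))
  (sqr_le (F (pointCn p)) (G (pointCn p))).
by rewrite mulrDl -!mulrA.
Qed.

Lemma weighted_sqnorm_le (w : Rn R n * Rn R n -> R) F G :
  measurable_fun [set: _] w -> (forall p, 0 <= w p <= 1) ->
  continuous F -> continuous G ->
  (\int[lebesgueCn R n]_p (w p * sqdens G p)%:E <=
   2%:E * \int[lebesgueCn R n]_p (w p * sqdens F p)%:E +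
   2%:E * fock_sqnorm (fun z => F z - G z)%R)%E.
Proof.
move=> mw w01 cF cG.
have w0 p : 0 <= w p by case/andP: (w01 p).
have w1 p : w p <= 1 by case/andP: (w01 p).
have cFG := continuous_subC cF cG.
have mF : measurable_fun [set: _] (fun p => (w p * sqdens F p)%:E).
  apply/measurable_EFinP; apply: measurable_funM => //.
  exact: measurable_sqdens.
have mG : measurable_fun [set: _] (fun p => (w p * sqdens G p)%:E).
  apply/measurable_EFinP; apply: measurable_funM => //.
  exact: measurable_sqdens.
have mFG : measurable_fun [set: _]
    (fun p => (sqdens (fun z => F z - G z) p)%:E).
  by apply/measurable_EFinP; exact: measurable_sqdens.
have pF p : (0 <= (w p * sqdens F p)%:E)%E.
  by rewrite lee_fin mulr_ge0// sqdens_ge0.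
have pG p : (0 <= (w p * sqdens G p)%:E)%E.
  by rewrite lee_fin mulr_ge0// sqdens_ge0.
have pFG p : (0 <= (sqdens (fun z => F z - G z) p)%:E)%E.
  by rewrite lee_fin sqdens_ge0.
rewrite fock_sqnormE -!ge0_integralZl// -ge0_integralD//; last 4 first.
- by move=> p _; rewrite mule_ge0.
- exact: measurable_funeM.
- by move=> p _; rewrite mule_ge0.
- exact: measurable_funeM.
apply: ge0_le_integral => //.
  by apply: emeasurable_funD; exact: measurable_funeM.
move=> p _; rewrite -!EFinM -EFinD lee_fin.
have := sqdens_le F G p; have := sqdens_ge0 (fun z => F z - G z) p.
have := w0 p; have := w1 p.
move: (w p) (sqdens F p) (sqdens G p) (sqdens (fun z => F z - G z) p).
move=> a b c d *.
have h : a * c <= a * (2 * b + 2 * d) by exact: ler_wpM2l.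
have h' : a * d <= d by rewrite ler_piMl.
by apply: le_trans h _; rewrite mulrDr mulrCA lerD2l mulrCA ler_pM2l.
Qed.

Lemma fock_sqnorm_sub_fin F G : in_fock F -> in_fock G ->
  (fock_sqnorm (fun z => F z - G z)%R < +oo)%E.
Proof.
move=> [eF nF] [eG nG].
have cF := entire_continuous eF; have cG := entire_continuous eG.
have cFG := continuous_subC cF cG.
have w1E F' : (\int[lebesgueCn R n]_p (1 * sqdens F' p)%:E)%E = fock_sqnorm F'.
  by apply: eq_integral => p _; rewrite mul1r.
have m1 : measurable_fun [set: Rn R n * Rn R n] (fun=> 1 : R).
  exact: measurable_cst.
have b1 (p : Rn R n * Rn R n) : 0 <= (1 : R) <= 1 by rewrite ler01 lexx.
have := weighted_sqnorm_le m1 b1 cF cFG; rewrite !w1E.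
rewrite (_ : (fun z => F z - (F z - G z)) = G); last first.
  by apply/funext => z; rewrite opprB addrC subrK.
move=> h; apply: le_lt_trans h _.
by rewrite lte_add_pinfty// lte_mul_pinfty.
Qed.

Variable i0 : 'I_n.

(** A positive bounded weight which tends to zero along the real direction
    of the coordinate [i0]. *)
Definition decay (p : Rn R n * Rn R n) : R := (1 + tnth p.1 i0 ^+ 2)^-1.

Lemma decay_gt0 p : 0 < decay p.
Proof. by rewrite invr_gt0 ltr_wpDr ?sqr_ge0. Qed.

Lemma decay_le1 p : decay p <= 1.
Proof. by rewrite invf_le1 ?lerDl ?sqr_ge0// ltr_wpDr ?sqr_ge0. Qed.

Lemma measurable_decay : measurable_fun [set: _] decay.
Proof.
have mq : measurable_fun [set: R] (fun x : R => (1 + x ^+ 2)^-1).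
  apply: continuous_measurable_fun => x; apply: cvgV.
    by rewrite gt_eqF// ltr_wpDr ?sqr_ge0.
  apply: cvgD; first exact: cvg_cst.
  exact: exprn_continuous.
apply: (measurableT_comp (f := fun x : R => (1 + x ^+ 2)^-1)) => //.
apply: (measurableT_comp (f := @tnth _ _ ^~ i0)) => //.
exact: measurable_tnth.
Qed.

Lemma decay_shift_cvg0 p : decay (shiftp k%:R p) @[k --> \oo] --> (0 : R).
Proof.
apply/cvgrPdist_lt => e e0; near=> k.
rewrite sub0r normrN gtr0_norm ?decay_gt0// /decay /= tnth_map.
set x := tnth p.1 i0.
have hk : `|x| + 1 + e^-1 < k%:R by near: k; exact: nbhs_infty_gtr.
have xk : 1 + e^-1 < x + k%:R by have := ler_norm (- x); rewrite normrN; lra.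
have ei : 0 < e^-1 by rewrite invr_gt0.
have q0 : 0 < 1 + (x + k%:R) ^+ 2 by rewrite ltr_wpDr ?sqr_ge0.
rewrite -[ltRHS]invrK ltf_pV2 ?posrE//.
nra.
Unshelve. all: by end_near. Qed.

(** After translation, the integrand is [decay (p + k) |H p|^2 e^(-|p|^2)],
    which tends to zero pointwise and is dominated by [|H p|^2 e^(-|p|^2)]. *)
Lemma weyl_weakly_null H : continuous H -> (fock_sqnorm H < +oo)%E ->
  (\int[lebesgueCn R n]_p (decay p * sqdens (weyl k%:R H) p)%:E)%E
    @[k --> \oo] --> 0%E.
Proof.
move=> cH nH.
have mH := measurable_sqdens cH.
have mS k : measurable_fun [set: _]
    (fun p => (decay (shiftp k%:R p) * sqdens H p)%:E).
  apply/measurable_EFinP; apply: measurable_funM => //.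
  apply: measurableT_comp; first exact: measurable_decay.
  by case: (measure_preserving_shiftp n (k%:R : R)).
have E k : (\int[lebesgueCn R n]_p (decay p * sqdens (weyl k%:R H) p)%:E =
    \int[lebesgueCn R n]_p (decay (shiftp k%:R p) * sqdens H p)%:E)%E.
  have := ge0_integral_measure_preserving (measure_preserving_shiftp n (- k%:R))
    measurableT (mS k); rewrite preimage_setT => <-; last first.
    by move=> p; rewrite lee_fin mulr_ge0 ?sqdens_ge0 ?(ltW (decay_gt0 _)).
  apply: eq_integral => p _; rewrite sqdens_weyl; congr (decay _ * _)%:E.
  by have := shiftpK (- k%:R) p; rewrite opprK => ->.
under eq_fun do rewrite E.
have iH : (lebesgueCn R n).-integrable [set: _] (EFin \o sqdens H).
  apply/integrableP; split; first exact/measurable_EFinP.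
  rewrite (_ : integral _ _ _ = fock_sqnorm H)//.
  by apply: eq_integral => p _ /=; rewrite ger0_norm ?sqdens_ge0.
pose f_ k p := (decay (shiftp k%:R p) * sqdens H p)%:E.
have f_cvg : {ae lebesgueCn R n,
    forall p, [set: _] p -> f_ ^~ p @ \oo --> cst 0%E p}.
  apply/aeW => p _; apply: cvg_EFin; first exact: nearW.
  rewrite -[X in _ --> X](mul0r (sqdens H p)); apply: cvgM; last exact: cvg_cst.
  exact: decay_shift_cvg0.
have f_le : {ae lebesgueCn R n, forall p k, [set: _] p ->
    (`|f_ k p| <= (EFin \o sqdens H) p)%E}.
  apply/aeW => p k _ /=; rewrite ger0_norm; last first.
    by rewrite mulr_ge0 ?sqdens_ge0 ?(ltW (decay_gt0 _)).
  by rewrite lee_fin ler_piMl ?sqdens_ge0 ?decay_le1.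
have [_ _] :=
  dominated_convergence measurableT mS (measurable_cst _) f_cvg iH f_le.
by rewrite integral0.
Qed.

Lemma fock_sqnorm_fin F :
  (fock_sqnorm F < +oo)%E -> fock_sqnorm F = (fock_norm F ^+ 2)%:E.
Proof.
move=> nF; rewrite sqr_sqrtr ?fine_ge0 ?fock_sqnorm_ge0// fineK//.
by rewrite ge0_fin_numE ?fock_sqnorm_ge0.
Qed.

(** The limit [G] has zero weighted norm, hence is zero, and the translates of
    [H] all have the norm of [H]. *)
Lemma weyl_orbit_limit_eq0 H G (s : nat -> nat) :
  in_fock H -> in_fock G -> {homo s : i j / (i < j)%N} ->
  fock_norm (fun z => weyl (s k)%:R H z - G z) @[k --> \oo] --> (0 : R) ->
  H = fun=> 0.
Proof.
move=> fH fG s_inc cvgs.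
have [eH nH] := fH; have [eG nG] := fG.
have cH := entire_continuous eH; have cG := entire_continuous eG.
have cvgA : fock_sqnorm (fun z => weyl (s k)%:R H z - G z) @[k --> \oo] --> 0%E.
  rewrite (_ : (fun k => _) =
      (fun k => (fock_norm (fun z => weyl (s k)%:R H z - G z) ^+ 2)%:E));
    last first.
    apply/funext => k; rewrite fock_sqnorm_fin//.
    exact: fock_sqnorm_sub_fin (in_fock_weyl _ fH) fG.
  apply: cvg_EFin; first exact: nearW.
  have h := cvgM cvgs cvgs; rewrite mulr0 in h; exact: h.
have s_ge k : (k <= s k)%N.
  by elim: k => // k IH; apply: leq_ltn_trans IH (s_inc _ _ (ltnSn k)).
have cvgB := weyl_weakly_null cH nH.
have cvgBs :
    (\int[lebesgueCn R n]_p (decay p * sqdens (weyl (s k)%:R H) p)%:E)%E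
    @[k --> \oo] --> 0%E.
  apply: (@cvg_comp _ _ _ s _ _ _ _ _ cvgB) => U [N _ NU].
  exists N => // k /= Nk.
  by apply: NU => /=; apply: leq_trans Nk _.
have G0 : G = fun=> 0.
  apply: (weighted_sqnorm_eq0 measurable_decay decay_gt0 cG).
  apply/eqP; rewrite eq_le; apply/andP; split; last first.
    apply: integral_ge0 => p _; rewrite lee_fin.
    by rewrite mulr_ge0 ?sqdens_ge0 ?(ltW (decay_gt0 _)).
  have lim0 : (2%:E *
      \int[lebesgueCn R n]_p (decay p * sqdens (weyl (s k)%:R H) p)%:E +
      2%:E * fock_sqnorm (fun z => weyl (s k)%:R H z - G z)%R)%E
      @[k --> \oo] --> 0%E.
    have e : (2%:E * 0 + 2%:E * 0)%E = 0%E :> \bar R by rewrite !mule0 adde0.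
    have fin2 : (2%:E : \bar R) \is a fin_num by [].
    have hB := cvgeZl fin2 cvgBs; have hA := cvgeZl fin2 cvgA.
    by rewrite -[X in _ --> X]e; apply: cvgeD hB hA; rewrite mule0.
  apply: cvge_ge lim0; apply: nearW => k.
  have decay01 p : 0 <= decay p <= 1 by rewrite decay_le1 ltW ?decay_gt0.
  have cW := entire_continuous (entire_weyl (s k)%:R eH).
  exact: weighted_sqnorm_le measurable_decay decay01 cW cG.
apply: fock_sqnorm_eq0 => //.
have cvgH : fock_sqnorm H @[k --> \oo] --> 0%E.
  rewrite (_ : (fun _ : nat => fock_sqnorm H) =
      (fun k => fock_sqnorm (fun z => weyl (s k)%:R H z - G z)))//.
  apply/funext => k; rewrite -(fock_sqnorm_weyl (s k)%:R cH); congr fock_sqnorm.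
  by apply/funext => z; rewrite G0 subr0.
by rewrite -(cvg_lim (@ereal_hausdorff R) cvgH) lim_cst.
Qed.

End escape.

(** * Compactness *)

Section compactness.
Context (R : realType) (n : nat).

Lemma fock_norm_weyl (a : R) (F : Cn R n -> C R) :
  continuous F -> fock_norm (weyl a F) = fock_norm F.
Proof. by move=> cF; rewrite /fock_norm fock_sqnorm_weyl. Qed.

(** A compact operator commuting with the Weyl translations vanishes. *)
Lemma compact_weyl_commuting_eq0 (T : (Cn R n -> C R) -> (Cn R n -> C R))
    (F : Cn R n -> C R) :
  (0 < n)%N -> compact_on_fock T -> in_fock F -> in_fock (T F) ->
  (forall a, T (weyl a F) = weyl a (T F)) -> T F = fun=> 0.
Proof.
move=> n_gt0 cT fF fTF commT.
have cF := entire_continuous fF.1.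
have [k||s [G [s_inc fG cvgs]]] := cT (fun k => weyl k%:R F).
- exact: in_fock_weyl.
- by exists (fock_norm F) => k; rewrite fock_norm_weyl.
apply: (weyl_orbit_limit_eq0 (Ordinal n_gt0) fTF fG s_inc).
by under eq_fun do rewrite -commT.
Qed.

(** At the origin the exponential is [1] and the integrand is
    [conj (phi(- conj w)) phi(- conj w)]. *)
Lemma S_op_refl_at0 (phi : Cn R n -> C R) :
  S_op phi (fock_refl phi) 0 = (fine (fock_sqnorm (fock_refl phi)))%:C.
Proof.
have E p : S_integrand phi (fock_refl phi) 0 (pointCn p) *
    (gauss_density (pointCn p))%:C = (sqdens (fock_refl phi) p)%:C.
  rewrite /S_integrand (_ : dotCn 0 _ = 0); last first.
    by rewrite /dotCn big1// => j _; rewrite mxE mul0r.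
  rewrite cexp0 mulr1 sub0r /sqdens /fock_refl normc_conj.
  rewrite -[- conjCn _]/(reflCn (pointCn p)) sqr_normcE.
  case: (phi _) => x y; apply/eqP; rewrite eq_complex /=.
  by apply/andP; split; apply/eqP; ring.
rewrite /S_op /gauss_integral /cintegral; apply/eqP; rewrite eq_complex /=.
apply/andP; split; apply/eqP.
  by apply: eq_Rintegral => p _; rewrite E.
under eq_Rintegral => p _ do rewrite E /=.
by rewrite Rintegral_cst ?mul0r.
Qed.

Lemma fock_refl_eq0 (phi : Cn R n -> C R) :
  fock_refl phi = (fun=> 0) -> phi = fun=> 0.
Proof.
move=> h; apply/funext => z; have := congr1 (fun f => f (reflCn z)) h.
by rewrite /fock_refl reflCnK => /eqP; rewrite conjc_eq0 => /eqP.
Qed.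

Lemma S_op0 (F : Cn R n -> C R) : S_op (fun=> 0) F = fun=> 0.
Proof.
apply/funext => z; rewrite /S_op /gauss_integral /cintegral /S_integrand.
apply/eqP; rewrite eq_complex; apply/andP; split; apply/eqP => /=.
  under eq_Rintegral => p _ do rewrite mulr0 mul0r /=.
  by rewrite Rintegral_cst ?mul0r.
under eq_Rintegral => p _ do rewrite mulr0 mul0r /=.
by rewrite Rintegral_cst ?mul0r.
Qed.

Lemma fock_sqnorm0 : fock_sqnorm ((fun=> 0) : Cn R n -> C R) = 0%E.
Proof.
rewrite fock_sqnormE -[RHS](@integral0 _ _ _ (lebesgueCn R n) [set: _]).
by apply: eq_integral => p _; rewrite /sqdens normc0 expr0n mul0r.
Qed.

Lemma in_fock0 : in_fock ((fun=> 0) : Cn R n -> C R).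
Proof.
split; last by rewrite fock_sqnorm0.
move=> z; exact: differentiable_cst.
Qed.

End compactness.

Theorem theorem5p5 (R : realType) (n : nat) (n_gt0 : (0 < n)%N)
    (phi : Cn R n -> C R) (phi_fock : in_fock phi) (phi_bdd : S_bounded phi)
    (m : Rn R n -> C R) (m_Linfty : in_Linfty (lebesgueRn R n) m)
    (phi_m : forall z : Cn R n,
      phi z = (powR (2 / pi) (n%:R / 2))%:C *
        cintegral (lebesgueRn R n)
          (fun x => m x * cexp (- 2 * shifted_sq x z))) :
  compact_on_fock (S_op phi) <-> phi = (fun=> 0).
Proof.
split=> [cS|->].
  have fr := in_fock_refl phi_fock.
  have S0 : S_op phi (fock_refl phi) = fun=> 0.
    apply: compact_weyl_commuting_eq0 => //.
      by case: phi_bdd => _ [+ _ _]; exact.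
    by move=> a; exact: S_op_weyl.
  apply: fock_refl_eq0; apply: fock_sqnorm_eq0.
    exact: entire_continuous fr.1.
  have : (fine (fock_sqnorm (fock_refl phi)))%:C = 0 :> C R.
    by rewrite -S_op_refl_at0 S0.
  move=> /(congr1 (@complex.Re R)) /= h.
  by rewrite -[LHS]fineK ?h// ge0_fin_numE ?fr.2// fock_sqnorm_ge0.
move=> F_ _ _; exists id, (fun=> 0); split=> //; first exact: in_fock0.
under eq_fun do rewrite S_op0 subr0.
rewrite (_ : fock_norm _ = 0); first exact: cvg_cst.
by rewrite /fock_norm fock_sqnorm0 sqrtr0.
Qed.
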